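(* Let $\mathcal{A}$ be a generic arrangement of $n$ hyperplanes in $\mathbb{R}^k$, $k<n$, and let $X\in\mathcal{L}(\mathcal{B}(n,k,\mathcal{A}))$ be an intersection of rank $n-k-1$. Then $X$ is a non-very generic intersection if and only if it is an arithmetic non-very generic (ANVG) intersection.
   Context: A central hyperplane arrangement $\mathcal{A}=\{H_1,\dots,H_n\}$ in $\mathbb{R}^k$ ($k<n$), with normals $\alpha_i$, is generic if any $m\le k$ of its hyperplanes intersect in codimension $m$. Identify $\mathbb{R}^n$ with the space of parallel translates via $(t_1,\dots,t_n)\mapsto(H_i+t_i\alpha_i)_i$. For $L\subset[n]$, $|L|=k+1$, $D_L=\{t\mid\bigcap_{i\in L}(H_i+t_i\alpha_i)\ne\emptyset\}$; $\mathcal{B}(n,k,\mathcal{A})=\{D_L\}$ is the discriminantal arrangement with intersection poset $\mathcal{L}(\mathcal{B}(n,k,\mathcal{A}))$. For $|S|\ge k+1$, $D_S=\bigcap_{L\subset S,|L|=k+1}D_L$. $D_S$ is a component of $X$ if $X\subset D_S$ and $X\not\subset D_{S\cup\{j\}}$ for all $j\notin S$; the canonical presentation $\{S_1,\dots,S_m\}$ of $X$ is the set of index sets of all its components. Athanasiadis rank $a_X=\sum_i(|S_i|-k)$; $\operatorname{rank}(X)$ is the codimension; $X$ is very generic if $\operatorname{rank}(X)=a_X$, non-very generic otherwise. A family $\{S_1,\dots,S_m\}$ satisfies the BBA-condition if $|\bigcup_{i\in I}S_i|>k+\sum_{i\in I}(|S_i|-k)$ for all $I\subset[m]$, $|I|\ge2$.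 A non-very generic intersection is ANVG if its canonical presentation fails the BBA-condition. *)

(* Defs.v *)
From HB Require Import structures.
From mathcomp Require Import all_boot all_order all_algebra.
From mathcomp Require Import boolp classical_sets reals.

Set Implicit Arguments.
Unset Strict Implicit.
Unset Printing Implicit Defensive.

Import GRing.Theory Num.Theory.
Local Open Scope classical_set_scope.
Local Open Scope ring_scope.

Definition codim (K : fieldType) (vT : vectType K) (V : {vspace vT}) : nat :=
  (\dim {:vT} - \dim V)%N.

Section Discriminantal.
Variables (R : realType) (n k : nat) (alpha : 'I_n -> 'rV[R]_k).

Definition hyperplane (i : 'I_n) : {vspace 'rV[R]_k} :=
  lker (linfun (mulmxr (alpha i)^T : 'rV[R]_k -> 'M[R]_1)).

Lemma mem_hyperplane i x :
  (x \in hyperplane i) = (\sum_(j < k) x 0 j * alpha i 0 j == 0).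
Proof.
rewrite memv_ker lfunE /=.
have -> : \sum_(j < k) x 0 j * alpha i 0 j = (x *m (alpha i)^T) 0 0.
  by rewrite mxE; apply: eq_bigr => j _; rewrite mxE.
apply/eqP/eqP => [->|h]; first by rewrite mxE.
by apply/matrixP => a b; rewrite !ord1 h mxE.
Qed.

(* For [n > 0] the first clause forces [k > 0]. *)
Definition generic_arrangement : Prop :=
  (forall i, alpha i != 0) /\
  (forall I : {set 'I_n}, (#|I| <= k)%N ->
     codim (\bigcap_(i in I) hyperplane i)%VS = #|I|).

Definition translate (t : 'rV[R]_n) (i : 'I_n) : set 'rV[R]_k :=
  [set x + t 0 i *: alpha i | x in [set` hyperplane i]].

Definition D (L : {set 'I_n}) : set 'rV[R]_n :=
  [set t | \bigcap_(i in [set` L]) translate t i !=set0].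

Definition DS (S : {set 'I_n}) : set 'rV[R]_n :=
  \bigcap_(L in [set L : {set 'I_n} | L \subset S /\ #|L| = k.+1]) D L.

(* The elements of the poset are carried as subspaces of R^n;
   [intersection_subspace] below shows that this excludes no intersection. *)
Definition intersection_poset : set {vspace 'rV[R]_n} :=
  [set X | exists2 F : {set {set 'I_n}},
     (forall L, L \in F -> #|L| = k.+1) &
     [set` X] = \bigcap_(L in [set` F]) D L].

Definition is_component (X : {vspace 'rV[R]_n}) (S : {set 'I_n}) : Prop :=
  [/\ (k < #|S|)%N, [set` X] `<=` DS S &
      forall j, j \notin S -> ~ ([set` X] `<=` DS (j |: S)%SET)].

Definition canonical_presentation (X : {vspace 'rV[R]_n}) : {set {set 'I_n}} :=
  [set S | `[< is_component X S >]]%SET.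

Definition athanasiadis_rank (X : {vspace 'rV[R]_n}) : nat :=
  (\sum_(S in canonical_presentation X) (#|S| - k))%N.

Definition very_generic (X : {vspace 'rV[R]_n}) : Prop :=
  codim X = athanasiadis_rank X.

Definition non_very_generic (X : {vspace 'rV[R]_n}) : Prop :=
  ~ very_generic X.

End Discriminantal.

Definition BBA_condition (n k : nat) (P : {set {set 'I_n}}) : Prop :=
  forall I : {set {set 'I_n}}, I \subset P -> (2 <= #|I|)%N ->
    (k + \sum_(S in I) (#|S| - k) < #|(\bigcup_(S in I) S)%SET|)%N.

Definition ANVG (R : realType) (n k : nat) (alpha : 'I_n -> 'rV[R]_k)
    (X : {vspace 'rV[R]_n}) : Prop :=
  non_very_generic alpha X /\
  ~ BBA_condition k (canonical_presentation alpha X).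

Lemma linear_set_vspace (K : fieldType) (vT : vectType K) (A : set vT) :
  A 0 -> (forall a u v, A u -> A v -> A (a *: u + v)) ->
  exists V : {vspace vT}, [set` V] = A.
Proof.
move=> A0 Alin.
pose P d := `[< exists2 V : {vspace vT}, [set` V] `<=` A & \dim V = d >].
have exP : exists d, P d.
  exists 0%N; apply/asboolP; exists 0%VS; last by rewrite dimv0.
  by move=> v /=; rewrite memv0 => /eqP ->.
have ubP d : P d -> (d <= \dim {:vT})%N.
  by move=> /asboolP[V _ <-]; apply/dimvS/subvf.
case: (ex_maxnP exP ubP) => d /asboolP[V VA dV] maxd.
exists V; apply/seteqP; split=> // x Ax /=.
have Pd : P (\dim (V + <[x]>)).
  apply/asboolP; exists (V + <[x]>)%VS => // w /= /memv_addP[v vV [u /vlineP[a ->] ->]].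
  by rewrite addrC; apply: Alin => //; apply: VA.
have /eqP VE : V == (V + <[x]>)%VS by rewrite eqEdim addvSl dV maxd.
by rewrite VE; apply: (subvP (addvSr V _)); apply: memv_line.
Qed.

Lemma intersection_subspace (R : realType) (n k : nat)
    (alpha : 'I_n -> 'rV[R]_k) (F : {set {set 'I_n}}) :
  exists X : {vspace 'rV[R]_n}, [set` X] = \bigcap_(L in [set` F]) D alpha L.
Proof.
apply: linear_set_vspace => [L _|a s t As At L LF].
  exists 0 => i _; exists 0; first exact: mem0v.
  by rewrite mxE scale0r addr0.
have [x xs] := As L LF; have [y yt] := At L LF.
exists (a *: x + y) => i iL.
have [u uH <-] := xs i iL; have [v vH <-] := yt i iL.
exists (a *: u + v); first by apply: memvD => //; apply: memvZ.
by rewrite !mxE scalerDr scalerDl scalerA addrACA.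
Qed.

(* Main.v *)
(** The bound codim X <= a_X always holds: X contains the intersection of the
    subspaces of translates having a common point on each component S, and each
    of these has codimension at most |S| - k.  If there are at least two
    components, BBA for the whole canonical presentation gives
    k + a_X < n, hence a_X <= n - k - 1 = codim X.  The same inequality holds if
    there is a single component S <> [n]; and S = [n] is impossible, since D_[n]
    meets trivially the (n-k)-dimensional space of translates fixing k chosen
    hyperplanes, whereas dim X = k + 1. *)
Require Import Defs.
From HB Require Import structures.
From mathcomp Require Import all_boot all_order all_algebra.
From mathcomp Require Import boolp classical_sets reals.
From mathcomp Require Import zify.

Set Implicit Arguments.
Unset Strict Implicit.
Unset Printing Implicit Defensive.

Import GRing.Theory Num.Theory.

Local Open Scope ring_scope.

Lemma exists_subset_card (T : finType) (A : {set T}) (m : nat) :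
  (m <= #|A|)%N -> exists2 K : {set T}, K \subset A & #|K| = m.
Proof.
rewrite -bin_gt0 -cards_draws => /card_gt0P[K].
by rewrite inE => /andP[KA /eqP cK]; exists K.
Qed.

Lemma codimvS (K : fieldType) (vT : vectType K) (U V : {vspace vT}) :
  (U <= V)%VS -> (codim V <= codim U)%N.
Proof. by move=> /dimvS UV; apply: leq_sub2l. Qed.

Lemma codimv_cap (K : fieldType) (vT : vectType K) (U V : {vspace vT}) :
  (codim (U :&: V) <= codim U + codim V)%N.
Proof.
rewrite /codim; have := dimv_sum_cap U V.
have := dimvS (subvf U); have := dimvS (subvf V).
have := dimvS (subvf (U + V)); lia.
Qed.

Lemma codimv_bigcap (K : fieldType) (vT : vectType K) (I : finType)
    (P : pred I) (V : I -> {vspace vT}) :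
  (codim (\bigcap_(i | P i) V i)%VS <= \sum_(i | P i) codim (V i))%N.
Proof.
elim/big_rec2: _ => [|i m U _ UleM]; first by rewrite /codim subnn.
by apply: leq_trans (codimv_cap _ _) _; rewrite leq_add2l.
Qed.

Lemma codimv_lker (K : fieldType) (aT rT : vectType K) (f : 'Hom(aT, rT)) :
  (codim (lker f) <= \dim {:rT})%N.
Proof.
rewrite /codim -(limg_ker_dim f fullv) capfv addKn; exact: dimvS (subvf _).
Qed.

(** The translates that leave the hyperplanes indexed by [A] in place. Writing it as an intersection
    of kernels of coordinate functionals bounds the codimension by counting them. *)
Definition vanishing_on (R : realType) (n : nat) (A : {set 'I_n}) :
    {vspace 'rV[R]_n} :=
  (\bigcap_(i in A)
     lker (linfun (mulmxr (delta_mx i 0%R) : 'rV[R]_n -> 'M[R]_1)))%VS.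

Lemma vanishing_onP (R : realType) (n : nat) (A : {set 'I_n}) (t : 'rV[R]_n) :
  reflect (forall i, i \in A -> t 0 i = 0) (t \in vanishing_on R A).
Proof.
have memE i : (t \in lker (linfun
    (mulmxr (delta_mx i 0%R) : 'rV[R]_n -> 'M[R]_1))) = (t 0 i == 0).
  rewrite memv_ker lfunE /= -colE.
  apply/eqP/eqP => [/matrixP/(_ 0 0)|ti0]; first by rewrite !mxE.
  by apply/matrixP=> a b; rewrite !ord1 !mxE.
rewrite memvE; apply: (iffP subv_bigcapP) => tA i /tA.
  by rewrite -memvE memE => /eqP.
by move=> ti0; rewrite -memvE memE ti0.
Qed.

Lemma codim_vanishing_on (R : realType) (n : nat) (A : {set 'I_n}) :
  (codim (vanishing_on R A) <= #|A|)%N.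
Proof.
apply: leq_trans (codimv_bigcap _ _) _.
rewrite -sum1_card; apply: leq_sum => i _.
by apply: leq_trans (codimv_lker _) _; rewrite dimvf.
Qed.

Section Concurrency.
Variables (R : realType) (n k : nat) (alpha : 'I_n -> 'rV[R]_k).

Lemma mem_translate (t : 'rV[R]_n) (i : 'I_n) (x : 'rV[R]_k) :
  translate alpha t i x <-> x - t 0 i *: alpha i \in hyperplane alpha i.
Proof.
split=> [[y yH <-]|xH]; first by rewrite addrK.
by exists (x - t 0 i *: alpha i) => //; rewrite subrK.
Qed.

Definition sqnorm (i : 'I_n) : R := \sum_(j < k) alpha i 0 j * alpha i 0 j.

(** Over the reals a sum of squares vanishes only if every term does. *)
Lemma sqnorm_neq0 (i : 'I_n) : alpha i != 0 -> sqnorm i != 0.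
Proof.
apply: contra => /eqP s0; apply/eqP/rowP => j; rewrite mxE; apply/eqP.
have /(_ j isT)/eqP := psumr_eq0P (fun j _ => sqr_ge0 (alpha i 0 j)) s0.
by rewrite mulf_eq0 orbb.
Qed.

Lemma mem_translateE (t : 'rV[R]_n) (i : 'I_n) (x : 'rV[R]_k) :
  translate alpha t i x <->
  \sum_(j < k) x 0 j * alpha i 0 j = t 0 i * sqnorm i.
Proof.
have E : \sum_(j < k) (x - t 0 i *: alpha i) 0 j * alpha i 0 j =
    \sum_(j < k) x 0 j * alpha i 0 j - t 0 i * sqnorm i.
  rewrite mulr_sumr -sumrB; apply: eq_bigr => j _.
  by rewrite !mxE mulrBl mulrA.
rewrite mem_translate mem_hyperplane E subr_eq0.
by split=> /eqP.
Qed.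

(* The t for which all translates pass through a common point x:
   t_i = <x, alpha_i> / <alpha_i, alpha_i>. *)
Definition point_translates : 'Hom('rV[R]_k, 'rV[R]_n) :=
  linfun (mulmxr (\matrix_(j < k, i < n) (alpha i 0 j / sqnorm i))).

Lemma point_translatesE (x : 'rV[R]_k) (i : 'I_n) :
  point_translates x 0 i = (\sum_(j < k) x 0 j * alpha i 0 j) / sqnorm i.
Proof.
by rewrite lfunE /= mxE mulr_suml; apply: eq_bigr => j _; rewrite mxE mulrA.
Qed.

(** The first summand chooses the common point of the translates indexed by [S]; the second leaves
    the coordinates outside [S] free. *)
Definition concurrent_on (S : {set 'I_n}) : {vspace 'rV[R]_n} :=
  (limg point_translates + vanishing_on R S)%VS.

Hypothesis alpha_gen : generic_arrangement alpha.

Lemma concurrent_on_D (S L : {set 'I_n}) (t : 'rV[R]_n) :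
  L \subset S -> t \in concurrent_on S -> D alpha L t.
Proof.
move=> LS /memv_addP[_ /memv_imgP[x _ ->] [z /vanishing_onP zS ->]].
exists x => i /= iL; apply/mem_translateE.
rewrite mxE (zS i (fintype.subsetP LS i iL)) addr0 point_translatesE divfK //.
exact/sqnorm_neq0/(proj1 alpha_gen).
Qed.

(** Any [k] of the hyperplanes in [A] already meet in codimension [k], hence only at the origin. *)
Lemma generic_point_eq0 (A : {set 'I_n}) (x : 'rV[R]_k) :
  (k <= #|A|)%N -> (forall i, i \in A -> x \in hyperplane alpha i) -> x = 0.
Proof.
move=> kA xH; have [K KA cK] := exists_subset_card kA.
have xU : x \in (\bigcap_(i in K) hyperplane alpha i)%VS.
  by rewrite memvE; apply/subv_bigcapP => i /(fintype.subsetP KA)/xH; rewrite memvE.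
have := proj2 alpha_gen K; rewrite cK => /(_ (leqnn k)); move: xU.
set U : {vspace 'rV[R]_k} := (\bigcap_(i in K) _)%VS => xU.
have := dimvS (subvf U); rewrite /codim dimvf /dim /= mul1n => dimle dimE.
have /eqP : \dim U = 0%N by lia.
by rewrite dimv_eq0 => /eqP U0; apply/eqP; rewrite -memv0 -U0.
Qed.

Lemma point_translates_eq0 (A : {set 'I_n}) (x : 'rV[R]_k) :
  (k <= #|A|)%N -> point_translates x \in vanishing_on R A -> x = 0.
Proof.
move=> kA /vanishing_onP xA; apply: (generic_point_eq0 kA) => i /xA /eqP.
rewrite point_translatesE mem_hyperplane mulf_eq0 invr_eq0.
by rewrite (negPf (sqnorm_neq0 (proj1 alpha_gen i))) orbF.
Qed.

(** By [point_translates_eq0], [point_translates] is injective and its image meets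
    [vanishing_on R S] trivially. So the dimension is at least [k + (n - #|S|)]. *)
Lemma codim_concurrent_on (S : {set 'I_n}) :
  (k <= #|S|)%N -> (codim (concurrent_on S) <= #|S| - k)%N.
Proof.
move=> kS.
have cap0 : (limg point_translates :&: vanishing_on R S)%VS = 0%VS.
  apply/eqP; rewrite -subv0; apply/subvP=> t /memv_capP[/memv_imgP[x _ ->]].
  by move=> /(point_translates_eq0 kS) ->; rewrite linear0 mem0v.
have ker0 : lker point_translates = 0%VS.
  apply/eqP; rewrite -subv0; apply/subvP=> x; rewrite memv_ker memv0 => /eqP x0.
  by apply/eqP/(point_translates_eq0 kS); rewrite x0 mem0v.
have := limg_ker_dim point_translates fullv; have := codim_vanishing_on R S.
have := dimv_disjoint_sum cap0.
rewrite /codim -/(concurrent_on S) ker0 capv0 dimv0 !dimvf /dim /= !mul1n.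
by rewrite add0n => -> Zle ->; rewrite addnC subnDA leq_sub2r.
Qed.

Lemma D_full_vanishing (K : {set 'I_n}) (t : 'rV[R]_n) :
  #|K| = k -> DS alpha [set: 'I_n]%SET t -> t \in vanishing_on R K -> t = 0.
Proof.
move=> cK tD /vanishing_onP tK; apply/rowP => i; rewrite mxE.
have [/tK //|iK] := boolP (i \in K).
(* The [k] unmoved hyperplanes of [K] force the common point [x] to be the origin; the translate of
   index [i] passes through it, so [t 0 i = 0]. *)
have [|x xL] := tD (i |: K)%SET; first by split; rewrite ?finset.subsetT ?cardsU1 ?iK ?cK.
have x0 : x = 0.
  apply: (@generic_point_eq0 K) => [|j jK]; first by rewrite cK.
  have /mem_translate : translate alpha t j x by apply: xL; rewrite /= !inE jK orbT.
  by rewrite tK // scale0r subr0.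
have /mem_translateE : translate alpha t i x by apply: xL; rewrite /= !inE eqxx.
rewrite x0 big1 => [|j _]; last by rewrite mxE mul0r.
move/esym/eqP; rewrite mulf_eq0 (negPf (sqnorm_neq0 (proj1 alpha_gen i))) orbF.
by move/eqP.
Qed.

Variable X : {vspace 'rV[R]_n}.

Lemma dim_sub_D_full : (k <= n)%N ->
  ([set` X] `<=` DS alpha [set: 'I_n]%SET)%classic -> (\dim X <= k)%N.
Proof.
move=> kn XD; have [|K _ cK] := @exists_subset_card _ [set: 'I_n]%SET k.
  by rewrite cardsT card_ord.
have cap0 : (X :&: vanishing_on R K)%VS = 0%VS.
  apply/eqP; rewrite -subv0; apply/subvP=> t /memv_capP[tX tK].
  by rewrite memv0; apply/eqP/(D_full_vanishing cK (XD _ tX)).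
have := dimv_disjoint_sum cap0; have := dimvS (subvf (X + vanishing_on R K)).
have := codim_vanishing_on R K; rewrite /codim cK !dimvf /dim /= mul1n; lia.
Qed.

(** A component is a maximal index set whose [DS] contains [X], so [L] can be enlarged to one. *)
Lemma component_of (L : {set 'I_n}) :
  #|L| = k.+1 -> ([set` X] `<=` D alpha L)%classic ->
  exists2 S : {set 'I_n}, S \in canonical_presentation alpha X & L \subset S.
Proof.
move=> cL XL.
pose p (S : {set 'I_n}) := `[< (k < #|S|)%N /\ ([set` X] `<=` DS alpha S)%classic >].
have pL : p L.
  apply/asboolP; split; first by rewrite cL.
  (* The only subset of [L] with [k.+1] elements is [L] itself. *)
  move=> t /XL tL L' [L'L cL']; suff -> : L' = L by [].
  by apply/eqP; rewrite eqEcard L'L cL cL' leqnn.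
have [S /maxsetP[/asboolP[kS XS] maxS] LS] := maxset_exists pL.
exists S => //; rewrite inE; apply/asboolP; split=> // j jS XjS.
move/negP: jS; apply.
rewrite -(maxS (j |: S)%SET) ?finset.subsetUr ?setU11 //.
apply/asboolP; split=> //; apply: leq_trans kS _.
exact/subset_leq_card/finset.subsetUr.
Qed.

Lemma codim_le_athanasiadis_rank :
  intersection_poset alpha X -> (codim X <= athanasiadis_rank alpha X)%N.
Proof.
move=> [F cF XE].
apply: leq_trans (_ : _ <= codim (\bigcap_(S in canonical_presentation alpha X)
  concurrent_on S)%VS)%N _.
  (* Each [L] defining [X] lies in some component [S], and concurrency on [S] implies concurrency on
     [L]. *)
  apply/codimvS/subvP => t tS.
  suff : [set` X]%classic t by [].
  rewrite XE => L LF.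
  have [|S SX LS] := @component_of L (cF _ LF).
    by rewrite XE => u; apply.
  apply: concurrent_on_D LS _; move: t tS; apply/subvP.
  exact: bigcapv_inf SX (subvv _).
apply: leq_trans (codimv_bigcap _ _) _; apply: leq_sum => S.
by rewrite inE => /asboolP[kS _ _]; apply/codim_concurrent_on/ltnW.
Qed.

End Concurrency.

Theorem theorem3p7 (R : realType) (n k : nat) (alpha : 'I_n -> 'rV[R]_k)
    (X : {vspace 'rV[R]_n})
    (hkn : (k < n)%N)
    (hgen : generic_arrangement alpha)
    (hX : intersection_poset alpha X)
    (hrank : codim X = (n - k - 1)%N) :
  non_very_generic alpha X <-> ANVG alpha X.
Proof.
split=> [nvg|[] //]; split=> // bba; apply: nvg.
apply/eqP; rewrite eqn_leq codim_le_athanasiadis_rank //= hrank.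
rewrite /athanasiadis_rank; set P := canonical_presentation alpha X in bba *.
have [P2|] := leqP 2 #|P|.
  (* BBA is needed only for the whole presentation, whose union has at most [n] elements. *)
  have := bba P (subxx _) P2.
  move=> /leq_trans/(_ (max_card _)); rewrite card_ord; lia.
rewrite ltnS leq_eqVlt => /orP[/cards1P[S PS]|]; last first.
  (* With no component the Athanasiadis rank is an empty sum. *)
  by rewrite ltnS leqn0 cards_eq0 => /eqP ->; rewrite big_set0.
have := set11 S; rewrite -{1}PS inE => /asboolP[kS XS _]; rewrite PS big_set1.
have [|nS] := ltnP #|S| n; first by lia.
have ST : S = [set: 'I_n]%SET.
  by apply/eqP; rewrite eqEcard finset.subsetT cardsT card_ord.
(* This gives [\dim X <= k], against the dimension [k + 1] forced by [hrank]. *)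
have := dim_sub_D_full hgen (ltnW hkn); rewrite -ST => /(_ _ XS).
move: hrank; have := dimvS (subvf X).
rewrite /codim dimvf /dim /= mul1n; lia.
Qed.
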